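(* Fix $(\tau,e)\in D_s$ with $\tau>0$, $e>0$, and consider the dynamical system for $\mathbf r=(\alpha,\varphi,\xi)\in\,]0,1[^3$: $$\begin{cases} \dot\alpha=\alpha(1-\alpha)\,\tau\Big(\dfrac{p_1}{T_1}-\dfrac{p_2}{T_2}\Big),\\[2mm] \dot\varphi=\varphi(1-\varphi)\Big(\dfrac{\mu_2}{T_2}-\dfrac{\mu_1}{T_1}\Big),\\[2mm] \dot\xi=\xi(1-\xi)\,e\Big(\dfrac1{T_1}-\dfrac1{T_2}\Big), \end{cases}$$ where $p_i,T_i,\mu_i$ denote the values of $p,T,\mu$ at $(\tau_i(\mathbf r),e_i(\mathbf r))$, $i=1,2$, with $$\tau_1(\mathbf r)=\frac{\alpha\tau}{\varphi},\quad \tau_2(\mathbf r)=\frac{(1-\alpha)\tau}{1-\varphi},\quad e_1(\mathbf r)=\frac{\xi e}{\varphi},\quad e_2(\mathbf r)=\frac{(1-\xi)e}{1-\varphi}.$$ The equilibrium states of this system (zeros of the right-hand side) are: 1. Saturation states: either $\mathbf r^*=(\alpha^*,\varphi^*,\xi^* )$ or $\mathbf r^\#=(1-\alpha^*,1-\varphi^*,1-\xi^* )$, with $\alpha^*\ne\varphi^*\ne\xi^*$ in $]0,1[$, such that $\tau_i(\mathbf r^* )=\tau_i^*$ and $e_i(\mathbf r^* )=e_i^*$ for $i=1,2$, and $\mathbf r^\#$ gives the same two phasic states with the labels of the two phases exchanged, where $(\tau_1^*,e_1^* )$ and $(\tau_2^*,e_2^* )$ are the saturation couple associated with $(\tau,e)$.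 2. Identification of phases 1 and 2: $\overline{\mathbf r}=(\beta,\beta,\beta)$ with $\beta\in\,]0,1[$, for which $\tau_1(\overline{\mathbf r})=\tau_2(\overline{\mathbf r})=\tau$ and $e_1(\overline{\mathbf r})=e_2(\overline{\mathbf r})=e$.
   Context: Notation: $\mathbb{R}^+=[0,+\infty)$. Fixed constants: $R>0$, $C_v>0$, $a\ge 0$, $b\ge 0$, $s_0\in\mathbb{R}$. The van der Waals specific entropy is $$s(\tau,e)=C_v\ln\Big(\frac{a}{\tau}+e\Big)+R\ln(\tau-b)+s_0,$$ defined on $D_s=\{(\tau,e)\in(\mathbb{R}^+)^2:\ \tau>b,\ \frac a\tau+e>0\}$. Temperature and pressure are $$T(\tau,e)=\frac1{C_v}\Big(e+\frac a\tau\Big)=\Big(\frac{\partial s}{\partial e}\Big)^{-1},\qquad p(\tau,e)=\frac{R\,T(\tau,e)}{\tau-b}-\frac{a}{\tau^2}=T\,\frac{\partial s}{\partial\tau},$$ and the chemical potential is $\mu(\tau,e)=e+p(\tau,e)\tau-T(\tau,e)s(\tau,e)$. The right-hand side of the system is defined for $\mathbf r\in\,]0,1[^3$ with both $(\tau_i(\mathbf r),e_i(\mathbf r))\in D_s$. Saturation couple associated with $(\tau,e)$ (when it exists): the unique couple of distinct states $(\tau_1^*,e_1^* ),(\tau_2^*,e_2^* )\in D_s$ (up to exchange of labels) such that $(\tau,e)$ lies on the segment joining them and $$p(\tau_1^*,e_1^* )=p(\tau_2^*,e_2^* ),\qquad \mu(\tau_1^*,e_1^* )=\mu(\tau_2^*,e_2^*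 ),\qquad T(\tau_1^*,e_1^* )=T(\tau_2^*,e_2^* ).$$ The saturation equilibria of item 1 are present when such a couple exists for $(\tau,e)$ with $(\tau,e)$ strictly between the two states; the equilibria of item 2 are present for every $(\tau,e)$.
   Formalization: The presence of the saturation equilibria is asserted only when both saturation energies e_1^*, e_2^* are positive: D_s allows e_i^*=0 (e.g. C_v=a/(τ_1^*T)), which would force ξ^*=0 or 1, so no equilibrium in ]0,1[^3 then exists. *)

(* Defs.v *)
From Stdlib Require Import Reals.
Open Scope R_scope.

Record vdw : Type := Vdw {
  Rg : R;
  Cv : R;
  a : R;
  b : R;
  s0 : R;
  Rg_pos : 0 < Rg;
  Cv_pos : 0 < Cv;
  a_nneg : 0 <= a;
  b_nneg : 0 <= b
}.

(* Specific volume [tau] and specific internal energy [en]. *)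
Record state : Type := State { tau : R; en : R }.

(* The domain of the entropy.  It is a subset of [0, +oo)^2: zero energy is
   allowed as soon as [0 < a / tau]. *)
Definition Ds (g : vdw) (x : state) : Prop :=
  0 <= tau x /\ 0 <= en x /\ b g < tau x /\ 0 < a g / tau x + en x.

(* The functions below are meaningful on [Ds] only; outside of it they take
   the values given by Stdlib's total [/] and [ln]. *)
Definition entropy (g : vdw) (x : state) : R :=
  Cv g * ln (a g / tau x + en x) + Rg g * ln (tau x - b g) + s0 g.

Definition temperature (g : vdw) (x : state) : R :=
  1 / Cv g * (en x + a g / tau x).

Definition pressure (g : vdw) (x : state) : R :=
  Rg g * temperature g x / (tau x - b g) - a g / tau x ^ 2.

Definition chempot (g : vdw) (x : state) : R :=
  en x + pressure g x * tau x - temperature g x * entropy g x.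

Definition convex_comb (t : R) (x1 x2 : state) : state :=
  State (t * tau x1 + (1 - t) * tau x2) (t * en x1 + (1 - t) * en x2).

Definition on_segment (x x1 x2 : state) : Prop :=
  exists t : R, 0 <= t <= 1 /\ x = convex_comb t x1 x2.

Definition strictly_between (x x1 x2 : state) : Prop :=
  exists t : R, 0 < t < 1 /\ x = convex_comb t x1 x2.

Definition saturated_pair (g : vdw) (x x1 x2 : state) : Prop :=
  Ds g x1 /\ Ds g x2 /\ x1 <> x2 /\ on_segment x x1 x2 /\
  pressure g x1 = pressure g x2 /\
  chempot g x1 = chempot g x2 /\
  temperature g x1 = temperature g x2.

(* [(x1, x2)] is THE saturation couple associated with [x]: uniqueness (up to
   exchange of the labels) is part of the notion. *)
Definition saturation_couple (g : vdw) (x x1 x2 : state) : Prop :=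
  saturated_pair g x x1 x2 /\
  forall y1 y2 : state, saturated_pair g x y1 y2 ->
    (y1 = x1 /\ y2 = x2) \/ (y1 = x2 /\ y2 = x1).

(* Volume, mass and energy fractions of phase 1. *)
Record fractions : Type := Fractions { alpha : R; phi : R; xi : R }.

Definition in_cube (r : fractions) : Prop :=
  0 < alpha r < 1 /\ 0 < phi r < 1 /\ 0 < xi r < 1.

Definition swap_labels (r : fractions) : fractions :=
  Fractions (1 - alpha r) (1 - phi r) (1 - xi r).

Definition phase1 (x : state) (r : fractions) : state :=
  State (alpha r * tau x / phi r) (xi r * en x / phi r).

Definition phase2 (x : state) (r : fractions) : state :=
  State ((1 - alpha r) * tau x / (1 - phi r))
        ((1 - xi r) * en x / (1 - phi r)).

(* The vector field of the dynamical system, with components ordered as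
   (alpha, phi, xi). *)
Definition rhs (g : vdw) (x : state) (r : fractions) : R * R * R :=
  let x1 := phase1 x r in
  let x2 := phase2 x r in
  let T1 := temperature g x1 in
  let T2 := temperature g x2 in
  (alpha r * (1 - alpha r) * tau x * (pressure g x1 / T1 - pressure g x2 / T2),
   phi r * (1 - phi r) * (chempot g x2 / T2 - chempot g x1 / T1),
   xi r * (1 - xi r) * en x * (1 / T1 - 1 / T2)).

(* [rhs] is considered only where both phasic states lie in [Ds]. *)
Definition in_domain (g : vdw) (x : state) (r : fractions) : Prop :=
  in_cube r /\ Ds g (phase1 x r) /\ Ds g (phase2 x r).

Definition equilibrium (g : vdw) (x : state) (r : fractions) : Prop :=
  in_domain g x r /\ rhs g x r = (0, 0, 0).

(* [alpha r <> phi r <> xi r] is a chain of two inequations: [alpha r = xi r]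
   can happen, namely when [x1], [x2] are aligned with the origin. *)
Definition saturation_state (x x1 x2 : state) (r : fractions) : Prop :=
  in_cube r /\ alpha r <> phi r /\ phi r <> xi r /\
  phase1 x r = x1 /\ phase2 x r = x2.

Definition identified_state (r : fractions) : Prop :=
  exists beta : R, 0 < beta < 1 /\ r = Fractions beta beta beta.

(* Main.v *)
(** An equilibrium consists of two phases with common temperature, pressure and
    chemical potential, so the only real issue is the uniqueness of the
    saturation couple.  If two distinct states share [T], [p] and [mu], the
    affine function [(e + p tau - mu) / T] dominates the entropy, with contact
    at these two states only: maximising the difference over [e] brings the
    temperature to [T], and along that isotherm the volume derivative is, up to a
    positive factor, a cubic with three roots and positive leading coefficient.
    When two such planes are built on couples whose segments both meet at a
    point, each dominates the other there, so the two planes have the same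
    contact points. *)

Require Import Defs.
From Stdlib Require Import Reals Lra.
From Coquelicot Require Import Coquelicot.
Open Scope R_scope.

(** * Isotherms of the van der Waals gas and their critical cubic *)

(** With [A = a], [B = b], [k = R T], this is the Helmholtz free energy at temperature [T] plus
    [p v], up to a term in [T] alone. Its derivative is [p] minus the pressure at volume [v] and
    temperature [T]. *)
Definition isotherm (A B k p v : R) : R := p * v - A / v - k * ln (v - B).

Definition isotherm' (A B k p v : R) : R := p + A / v ^ 2 - k / (v - B).

Lemma isotherm_derive (A B k p v : R) :
  0 <= B -> B < v ->
  derivable_pt_lim (isotherm A B k p) v (isotherm' A B k p v).
Proof.
  intros hB hv. apply is_derive_Reals. unfold isotherm, isotherm'.
  auto_derive.
  - repeat split; lra.
  - field; lra.
Qed.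

Lemma isotherm_mvt (A B k p u v : R) :
  0 <= B -> B < u -> u < v ->
  exists c, isotherm A B k p v - isotherm A B k p u
            = isotherm' A B k p c * (v - u) /\ u < c < v.
Proof.
  intros hB hu huv. apply MVT_cor2; [exact huv|].
  intros c hc. apply isotherm_derive; lra.
Qed.

Definition critical_cubic (A B k p v : R) : R :=
  p * v ^ 2 * (v - B) - k * v ^ 2 + A * (v - B).

Lemma isotherm'_cubic (A B k p v : R) :
  0 <= B -> B < v ->
  isotherm' A B k p v = critical_cubic A B k p v / (v ^ 2 * (v - B)).
Proof.
  intros hB hv. unfold isotherm', critical_cubic. field; lra.
Qed.

Lemma critical_cubic_root (A B k p v : R) :
  0 <= B -> B < v -> isotherm' A B k p v = 0 -> critical_cubic A B k p v = 0.
Proof.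
  intros hB hv h.
  replace (critical_cubic A B k p v)
    with (isotherm' A B k p v * (v ^ 2 * (v - B)))
    by (unfold isotherm', critical_cubic; field; lra).
  rewrite h; ring.
Qed.

(** First and then second divided differences of the cubic yield its coefficients one after the
    other. The relations stay multiplied by [p], which is not yet known to be nonzero. *)
Lemma critical_cubic_vieta (A B k p u v w : R) :
  u <> v -> v <> w -> u <> w ->
  critical_cubic A B k p u = 0 -> critical_cubic A B k p v = 0 ->
  critical_cubic A B k p w = 0 ->
  p * (u + v + w) = p * B + k /\ p * (u * v + v * w + u * w) = A /\
  p * (u * v * w) = A * B.
Proof.
  unfold critical_cubic. intros huv hvw huw hu hv hw.
  assert (e1 : p * (u ^ 2 + u * v + v ^ 2) - (p * B + k) * (u + v) + A = 0).
  { apply (Rmult_eq_reg_l (u - v)); [|lra]. lra. }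
  assert (e2 : p * (v ^ 2 + v * w + w ^ 2) - (p * B + k) * (v + w) + A = 0).
  { apply (Rmult_eq_reg_l (v - w)); [|lra]. lra. }
  assert (e3 : p * (u + v + w) = p * B + k).
  { apply (Rmult_eq_reg_l (u - w)); [|lra]. lra. }
  assert (hk : k = p * (u + v + w) - p * B) by lra.
  subst k.
  assert (e4 : p * (u * v + v * w + u * w) = A) by lra.
  repeat split; try lra.
  rewrite <- e4 in hu |- *. lra.
Qed.

Lemma critical_cubic_factor (A B k p u v w z : R) :
  u <> v -> v <> w -> u <> w ->
  critical_cubic A B k p u = 0 -> critical_cubic A B k p v = 0 ->
  critical_cubic A B k p w = 0 ->
  critical_cubic A B k p z = p * ((z - u) * (z - v) * (z - w)).
Proof.
  intros huv hvw huw hu hv hw.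
  destruct (critical_cubic_vieta _ _ _ _ _ _ _ huv hvw huw hu hv hw)
    as [h1 [h2 h3]].
  assert (hk : k = p * (u + v + w) - p * B) by lra.
  unfold critical_cubic.
  replace (p * z ^ 2 * (z - B) - k * z ^ 2 + A * (z - B))
    with (p * z ^ 3 - (p * B + k) * z ^ 2 + A * z - A * B) by ring.
  rewrite <- h3, <- h1, <- h2. ring.
Qed.

(** * Isotherms with two critical points at the same height *)

Section Bitangent.

Context (A B k p v1 v2 : R).
Context (hA : 0 <= A) (hB : 0 <= B) (hk : 0 < k) (h1 : B < v1) (h12 : v1 < v2).
Context (d1 : isotherm' A B k p v1 = 0) (d2 : isotherm' A B k p v2 = 0).
Context (heq : isotherm A B k p v1 = isotherm A B k p v2).

(* The intermediate root is the unstable (spinodal) state given by Rolle. *)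
Lemma bitangent_sign :
  0 < A /\ exists v3 q, v1 < v3 < v2 /\ 0 < q /\
  forall z, B < z ->
    isotherm' A B k p z
    = q * ((z - v1) * (z - v3) * (z - v2)) / (z ^ 2 * (z - B)).
Proof.
  destruct (isotherm_mvt A B k p v1 v2 hB h1 h12) as [v3 [e3 b3]].
  assert (d3 : isotherm' A B k p v3 = 0).
  { apply (Rmult_eq_reg_r (v2 - v1)); [|lra]. lra. }
  apply critical_cubic_root in d1; [|lra|lra].
  apply critical_cubic_root in d2; [|lra|lra].
  apply critical_cubic_root in d3; [|lra|lra].
  destruct (critical_cubic_vieta A B k p v1 v3 v2) as [s1 [s2 s3]];
    try lra; try assumption.
  (* The product of the roots gives [p >= 0], and with [p = 0] the sum relation would force
     [k = 0]. *)
  assert (hp : 0 < p).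
  { assert (0 < v1 * v3 * v2) by (repeat apply Rmult_lt_0_compat; lra).
    assert (0 <= A * B) by (apply Rmult_le_pos; lra).
    assert (p <> 0) by (intros ->; lra).
    nra. }
  split.
  - rewrite <- s2. apply Rmult_lt_0_compat; [lra|].
    assert (0 < v1 * v3) by (apply Rmult_lt_0_compat; lra).
    assert (0 < v3 * v2) by (apply Rmult_lt_0_compat; lra).
    assert (0 < v1 * v2) by (apply Rmult_lt_0_compat; lra).
    lra.
  - exists v3, p. split; [lra|split; [lra|]]. intros z hz.
    rewrite isotherm'_cubic by lra.
    rewrite (critical_cubic_factor A B k p v1 v3 v2 z); try lra; assumption.
Qed.

(** The derivative has signs -, +, -, + on the intervals cut out by [v1 < v3 < v2], and the heights
    at [v1] and [v2] agree. On each interval the mean value theorem compares [v] with the adjacent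
    minimum. *)
Lemma bitangent_min (v : R) :
  B < v -> v <> v1 -> v <> v2 -> isotherm A B k p v1 < isotherm A B k p v.
Proof.
  intros hv n1 n2.
  destruct bitangent_sign as [_ [v3 [q [b3 [hq hd]]]]].
  assert (sgn : forall z, B < z -> exists w, 0 < w /\
    isotherm' A B k p z = w * ((z - v1) * (z - v3) * (z - v2))).
  { intros z hz. exists (q / (z ^ 2 * (z - B))). split.
    - apply Rdiv_lt_0_compat; [lra|].
      apply Rmult_lt_0_compat; [apply pow_lt|]; lra.
    - rewrite hd by lra. field. lra. }
  destruct (Rlt_le_dec v v1) as [c1|c1];
    [|destruct (Rle_lt_dec v v3) as [c3|c3];
      [|destruct (Rlt_le_dec v v2) as [c2|c2]]].
  - destruct (isotherm_mvt A B k p v v1 hB hv c1) as [c [e [l u]]].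
    destruct (sgn c) as [w [hw hs]]; [lra|].
    assert (0 < w * ((v1 - c) * (v3 - c) * (v2 - c)) * (v1 - v))
      by (repeat apply Rmult_lt_0_compat; lra).
    rewrite hs in e. lra.
  - destruct (isotherm_mvt A B k p v1 v hB h1) as [c [e [l u]]]; [lra|].
    destruct (sgn c) as [w [hw hs]]; [lra|].
    assert (0 < w * ((c - v1) * (v3 - c) * (v2 - c)) * (v - v1))
      by (repeat apply Rmult_lt_0_compat; lra).
    rewrite hs in e. lra.
  - destruct (isotherm_mvt A B k p v v2 hB hv c2) as [c [e [l u]]].
    destruct (sgn c) as [w [hw hs]]; [lra|].
    assert (0 < w * ((c - v1) * (c - v3) * (v2 - c)) * (v2 - v))
      by (repeat apply Rmult_lt_0_compat; lra).
    rewrite hs in e. lra.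
  - destruct (isotherm_mvt A B k p v2 v hB) as [c [e [l u]]]; [lra|lra|].
    destruct (sgn c) as [w [hw hs]]; [lra|].
    assert (0 < w * ((c - v1) * (c - v3) * (c - v2)) * (v - v2))
      by (repeat apply Rmult_lt_0_compat; lra).
    rewrite hs in e. lra.
Qed.

End Bitangent.

(** * Coexisting states on a common isotherm *)

(** This is [saturated_pair] without the segment condition: the supporting plane depends on the
    couple only, not on the point chosen between its states. *)
Definition coexist (g : vdw) (x1 x2 : state) : Prop :=
  Ds g x1 /\ Ds g x2 /\ x1 <> x2 /\
  pressure g x1 = pressure g x2 /\
  chempot g x1 = chempot g x2 /\
  temperature g x1 = temperature g x2.

Lemma coexist_sym (g : vdw) (x1 x2 : state) : coexist g x1 x2 -> coexist g x2 x1.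
Proof. unfold coexist. intuition congruence. Qed.

Lemma temperature_pos (g : vdw) (x : state) : Ds g x -> 0 < temperature g x.
Proof.
  intros [_ [_ [_ h]]]. unfold temperature. pose proof (Cv_pos g).
  apply Rmult_lt_0_compat; [apply Rdiv_lt_0_compat|]; lra.
Qed.

Lemma en_temperature (g : vdw) (x : state) :
  en x = Cv g * temperature g x - a g / tau x.
Proof.
  unfold temperature. pose proof (Cv_pos g).
  (* Abstracting the quotient spares [field] the condition [tau x <> 0], so the identity holds
     outside [Ds] too. *)
  generalize (a g / tau x) as w. intro w. field; lra.
Qed.

Lemma state_eq (x y : state) : tau x = tau y -> en x = en y -> x = y.
Proof. destruct x, y; simpl; intros -> ->; reflexivity. Qed.

Lemma state_eq_temperature (g : vdw) (x y : state) :
  temperature g x = temperature g y -> tau x = tau y -> x = y.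
Proof.
  intros hT ht. apply state_eq; [exact ht|].
  rewrite (en_temperature g x), (en_temperature g y), hT, ht. reflexivity.
Qed.

Lemma coexist_tau_neq (g : vdw) (x1 x2 : state) :
  coexist g x1 x2 -> tau x1 <> tau x2.
Proof.
  intros [_ [_ [hn [_ [_ hT]]]]] ht. apply hn.
  exact (state_eq_temperature g _ _ hT ht).
Qed.

Lemma isotherm'_pressure (g : vdw) (x : state) :
  isotherm' (a g) (b g) (Rg g * temperature g x) (pressure g x) (tau x) = 0.
Proof. unfold isotherm', pressure. ring. Qed.

(** Eliminating the energy in favour of the temperature leaves a remainder in [T] alone. Hence
    states sharing [p], [T] and [mu] lie at the same height of their isotherm, which is the
    hypothesis [heq] above. *)
Lemma isotherm_chempot (g : vdw) (x : state) :
  isotherm (a g) (b g) (Rg g * temperature g x) (pressure g x) (tau x)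
  = chempot g x - Cv g * temperature g x
    + temperature g x * (Cv g * ln (Cv g * temperature g x) + s0 g).
Proof.
  unfold chempot, entropy, isotherm.
  rewrite (en_temperature g x).
  replace (a g / tau x + (Cv g * temperature g x - a g / tau x))
    with (Cv g * temperature g x) by ring.
  ring.
Qed.

Lemma ln_lt_sub1 (y : R) : 0 < y -> y <> 1 -> ln y < y - 1.
Proof.
  intros hy h1.
  assert (hl : ln y <> 0).
  { intro h. apply h1. rewrite <- (exp_ln y hy), h. apply exp_0. }
  pose proof (exp_ineq1 _ hl) as h. rewrite exp_ln in h by lra. lra.
Qed.

Lemma coexist_isotherm (g : vdw) (x1 x2 : state) :
  coexist g x1 x2 -> tau x1 < tau x2 ->
  0 < a g /\
  forall v, b g < v -> v <> tau x1 -> v <> tau x2 ->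
    isotherm (a g) (b g) (Rg g * temperature g x1) (pressure g x1) (tau x1)
    < isotherm (a g) (b g) (Rg g * temperature g x1) (pressure g x1) v.
Proof.
  intros [D1 [D2 [_ [hp [hm hT]]]]] hlt.
  pose proof (temperature_pos g x1 D1). pose proof (Rg_pos g).
  pose proof (isotherm'_pressure g x1) as d1.
  pose proof (isotherm'_pressure g x2) as d2.
  pose proof (isotherm_chempot g x1) as m1.
  pose proof (isotherm_chempot g x2) as m2.
  rewrite <- hm, <- hT, <- hp in m2. rewrite <- hT, <- hp in d2.
  assert (0 < Rg g * temperature g x1) by (apply Rmult_lt_0_compat; lra).
  destruct D1 as [_ [_ [hb1 _]]].
  pose proof (a_nneg g). pose proof (b_nneg g).
  split.
  - eapply (bitangent_sign (a g) (b g)); eauto; lra.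
  - intros v hv n1 n2. apply (bitangent_min _ _ _ _ _ (tau x2)); auto; lra.
Qed.

Lemma coexist_a_pos (g : vdw) (x1 x2 : state) : coexist g x1 x2 -> 0 < a g.
Proof.
  intros h. destruct (Rtotal_order (tau x1) (tau x2)) as [l|[e|l]].
  - exact (proj1 (coexist_isotherm g x1 x2 h l)).
  - destruct (coexist_tau_neq _ _ _ h e).
  - exact (proj1 (coexist_isotherm g x2 x1 (coexist_sym _ _ _ h) l)).
Qed.

(** At a common temperature the energy is [Cv T - a / tau], which is injective in the volume because
    coexistence forces [a > 0]. *)
Lemma coexist_en_neq (g : vdw) (x1 x2 : state) :
  coexist g x1 x2 -> en x1 <> en x2.
Proof.
  intros h e. apply (coexist_tau_neq g x1 x2 h).
  pose proof (coexist_a_pos _ _ _ h) as ha.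
  destruct h as [[_ [_ [b1 _]]] [[_ [_ [b2 _]]] [_ [_ [_ hT]]]]].
  pose proof (b_nneg g).
  rewrite (en_temperature g x1), (en_temperature g x2), hT in e.
  assert (hq : a g / tau x1 = a g / tau x2) by lra.
  assert (hr : a g * tau x2 = a g * tau x1).
  { replace (a g * tau x2) with (a g / tau x1 * (tau x1 * tau x2)) by (field; lra).
    rewrite hq. field; lra. }
  symmetry. apply (Rmult_eq_reg_l (a g)); lra.
Qed.

(** * Supporting planes of the entropy and uniqueness of the couple *)

(** For [x0] in [Ds] this is the first-order expansion of the entropy at [x0], whose partial
    derivatives are [1 / T] in energy and [p / T] in volume. It depends on [x0] through [p], [mu]
    and [T] only, so coexisting states have the same plane. *)
Definition tangent_plane (g : vdw) (x0 x : state) : R :=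
  (en x + pressure g x0 * tau x - chempot g x0) / temperature g x0.

Lemma tangent_plane_eq (g : vdw) (x0 x1 x : state) :
  pressure g x0 = pressure g x1 -> chempot g x0 = chempot g x1 ->
  temperature g x0 = temperature g x1 ->
  tangent_plane g x0 x = tangent_plane g x1 x.
Proof. unfold tangent_plane. intros -> -> ->. reflexivity. Qed.

Lemma tangent_plane_refl (g : vdw) (x : state) :
  Ds g x -> tangent_plane g x x = entropy g x.
Proof.
  intros h. apply temperature_pos in h. unfold tangent_plane, chempot.
  field; lra.
Qed.

Lemma tangent_plane_comb (g : vdw) (x0 x1 x2 : state) (t : R) :
  Ds g x0 ->
  tangent_plane g x0 (convex_comb t x1 x2)
  = t * tangent_plane g x0 x1 + (1 - t) * tangent_plane g x0 x2.
Proof.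
  intros h. apply temperature_pos in h. unfold tangent_plane, convex_comb; simpl.
  field; lra.
Qed.

(** The gap splits exactly into the isotherm difference and [Cv T (q - 1 - ln q)], where [q] is the
    ratio of the two temperatures. The second term is nonnegative and vanishes only for [q = 1]. *)
Lemma isotherm_le_gap (g : vdw) (x0 y : state) :
  Ds g x0 -> Ds g y ->
  let T := temperature g x0 in
  let F := isotherm (a g) (b g) (Rg g * T) (pressure g x0) in
  let gap := T * (tangent_plane g x0 y - entropy g y) in
  F (tau y) - F (tau x0) <= gap /\
  (temperature g y <> T -> F (tau y) - F (tau x0) < gap).
Proof.
  intros D0 Dy T F gap.
  pose proof (temperature_pos g x0 D0) as hT.
  pose proof (temperature_pos g y Dy) as hy.
  pose proof (Cv_pos g) as hC.
  assert (ht : 0 < tau y) by (pose proof (b_nneg g); destruct Dy; lra).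
  set (q := temperature g y / T).
  assert (hq : 0 < q) by (apply Rdiv_lt_0_compat; assumption).
  assert (e : gap = F (tau y) - F (tau x0) + Cv g * T * (q - 1 - ln q)).
  { pose proof (isotherm_chempot g x0) as m0. fold T in m0. fold F in m0.
    rewrite m0. unfold gap, F.
    unfold tangent_plane, entropy, isotherm.
    rewrite (en_temperature g y).
    replace (a g / tau y + (Cv g * temperature g y - a g / tau y))
      with (Cv g * T * q) by (unfold q; field; unfold T in *; lra).
    rewrite (ln_mult (Cv g * T) q); [|apply Rmult_lt_0_compat; assumption|exact hq].
    unfold q; fold T. field. unfold T; lra. }
  assert (hCT : 0 < Cv g * T) by (apply Rmult_lt_0_compat; assumption).
  assert (strict : temperature g y <> T -> F (tau y) - F (tau x0) < gap).
  { intros hn.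
    assert (q <> 1).
    { intro h1. apply hn. replace (temperature g y) with (q * T)
        by (unfold q; field; unfold T; lra). rewrite h1; ring. }
    pose proof (ln_lt_sub1 q hq H).
    assert (0 < Cv g * T * (q - 1 - ln q)) by (apply Rmult_lt_0_compat; lra).
    lra. }
  split; [|exact strict].
  destruct (Req_dec (temperature g y) T) as [h|h]; [|apply Rlt_le; auto].
  assert (q = 1) as h1 by (unfold q; rewrite h; field; unfold T; lra).
  rewrite e, h1, ln_1. lra.
Qed.

Lemma support_lt (g : vdw) (x1 x2 : state) :
  coexist g x1 x2 -> tau x1 < tau x2 ->
  forall y, Ds g y -> y <> x1 -> y <> x2 -> entropy g y < tangent_plane g x1 y.
Proof.
  intros h hlt y Dy n1 n2.
  destruct (coexist_isotherm g x1 x2 h hlt) as [_ hmin].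
  pose proof h as [D1 [D2 [_ [hp [hm hT]]]]].
  pose proof (temperature_pos g x1 D1) as hT1.
  destruct (isotherm_le_gap g x1 y D1 Dy) as [hle hst].
  set (F := isotherm (a g) (b g) (Rg g * temperature g x1) (pressure g x1)) in *.
  assert (hF12 : F (tau x2) = F (tau x1)).
  { unfold F. rewrite (isotherm_chempot g x1), hp, hm, hT. apply isotherm_chempot. }
  assert (hF : F (tau x1) <= F (tau y)).
  { destruct (Req_dec (tau y) (tau x1)) as [->|m1]; [lra|].
    destruct (Req_dec (tau y) (tau x2)) as [->|m2]; [lra|].
    apply Rlt_le, hmin; auto. apply Dy. }
  (* A different temperature makes the energy term strict. At equal temperature the volume
     determines the state, so the volume of [y] is neither of the two minima and the isotherm term
     is strict. *)
  assert (0 < temperature g x1 * (tangent_plane g x1 y - entropy g y)).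
  { destruct (Req_dec (temperature g y) (temperature g x1)) as [e|e];
      [|specialize (hst e); lra].
    assert (F (tau x1) < F (tau y)); [|lra].
    apply hmin; [apply Dy| |]; intro ht.
    - apply n1, (state_eq_temperature g); auto.
    - apply n2, (state_eq_temperature g); congruence. }
  nra.
Qed.

Lemma support (g : vdw) (x1 x2 : state) :
  coexist g x1 x2 ->
  forall y, Ds g y -> y <> x1 -> y <> x2 -> entropy g y < tangent_plane g x1 y.
Proof.
  intros h y Dy n1 n2. destruct (Rtotal_order (tau x1) (tau x2)) as [l|[e|l]].
  - exact (support_lt g x1 x2 h l y Dy n1 n2).
  - destruct (coexist_tau_neq _ _ _ h e).
  - rewrite (tangent_plane_eq g x1 x2); try apply h.
    exact (support_lt g x2 x1 (coexist_sym _ _ _ h) l y Dy n2 n1).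
Qed.

Lemma support_contact (g : vdw) (x1 x2 : state) :
  coexist g x1 x2 ->
  tangent_plane g x1 x1 = entropy g x1 /\ tangent_plane g x1 x2 = entropy g x2.
Proof.
  intros h. pose proof h as [D1 [D2 [_ [hp [hm hT]]]]]. split.
  - apply tangent_plane_refl, D1.
  - rewrite (tangent_plane_eq g x1 x2) by assumption. apply tangent_plane_refl, D2.
Qed.

Lemma support_le (g : vdw) (x1 x2 y : state) :
  coexist g x1 x2 -> Ds g y ->
  entropy g y <= tangent_plane g x1 y /\
  (entropy g y = tangent_plane g x1 y -> y = x1 \/ y = x2).
Proof.
  intros h Dy. destruct (support_contact g x1 x2 h) as [c1 c2].
  assert (dec : forall u v : state, u = v \/ u <> v).
  { intros u v. destruct (Req_dec (tau u) (tau v)); [|right; congruence].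
    destruct (Req_dec (en u) (en v)); [|right; congruence].
    left; apply state_eq; assumption. }
  destruct (dec y x1) as [->|n1]; [split; [lra|auto]|].
  destruct (dec y x2) as [->|n2]; [split; [lra|auto]|].
  pose proof (support g x1 x2 h y Dy n1 n2). split; lra.
Qed.

(** On the segment of its own couple, each plane is the convex combination of the two entropies,
    which the other plane dominates. The planes thus agree at [x], and since [x] is interior to the
    segment of [x1], [x2], both of these are contact points of the plane of [y1], [y2]. *)
Lemma coexist_unique (g : vdw) (x x1 x2 y1 y2 : state) :
  coexist g x1 x2 -> coexist g y1 y2 ->
  strictly_between x x1 x2 -> on_segment x y1 y2 ->
  (y1 = x1 /\ y2 = x2) \/ (y1 = x2 /\ y2 = x1).
Proof.
  intros hx hy [t [ht ex]] [s [hs ey]].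
  pose proof (proj1 hx) as Dx1. pose proof (proj1 (proj2 hx)) as Dx2.
  pose proof (proj1 hy) as Dy1. pose proof (proj1 (proj2 hy)) as Dy2.
  destruct (support_contact g x1 x2 hx) as [cx1 cx2].
  destruct (support_contact g y1 y2 hy) as [cy1 cy2].
  destruct (support_le g x1 x2 y1 hx Dy1) as [ly1 _].
  destruct (support_le g x1 x2 y2 hx Dy2) as [ly2 _].
  destruct (support_le g y1 y2 x1 hy Dx1) as [lx1 ex1].
  destruct (support_le g y1 y2 x2 hy Dx2) as [lx2 ex2].
  pose proof (tangent_plane_comb g x1 x1 x2 t Dx1) as a1.
  pose proof (tangent_plane_comb g x1 y1 y2 s Dx1) as a2.
  pose proof (tangent_plane_comb g y1 x1 x2 t Dy1) as a3.
  pose proof (tangent_plane_comb g y1 y1 y2 s Dy1) as a4.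
  rewrite <- ex in a1, a3. rewrite <- ey in a2, a4.
  (* Seen on the segment of [y1], [y2]; the converse inequality comes from [z1] and [z2]. *)
  assert (le : tangent_plane g y1 x <= tangent_plane g x1 x).
  { rewrite a4, a2, cy1, cy2. nra. }
  assert (z1 : 0 <= t * (tangent_plane g y1 x1 - entropy g x1))
    by (apply Rmult_le_pos; lra).
  assert (z2 : 0 <= (1 - t) * (tangent_plane g y1 x2 - entropy g x2))
    by (apply Rmult_le_pos; lra).
  rewrite a3, a1, cx1, cx2 in le.
  (* Two nonnegative terms with nonpositive sum vanish, and the weights [t] and [1 - t] are
     positive. *)
  assert (x1 = y1 \/ x1 = y2).
  { apply ex1, (Rmult_eq_reg_l t); lra. }
  assert (x2 = y1 \/ x2 = y2).
  { apply ex2, (Rmult_eq_reg_l (1 - t)); lra. }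
  assert (x1 <> x2) by apply hx.
  intuition congruence.
Qed.

(** * Fractions, phasic states and exchange of labels *)

Lemma fractions_eq (r s : fractions) :
  alpha r = alpha s -> phi r = phi s -> xi r = xi s -> r = s.
Proof. destruct r, s; simpl; intros -> -> ->; reflexivity. Qed.

Lemma phase1_swap (x : state) (r : fractions) :
  phase1 x (swap_labels r) = phase2 x r.
Proof. reflexivity. Qed.

Lemma phase2_swap (x : state) (r : fractions) :
  phase2 x (swap_labels r) = phase1 x r.
Proof.
  unfold phase1, phase2, swap_labels; simpl.
  replace (1 - (1 - alpha r)) with (alpha r) by ring.
  replace (1 - (1 - phi r)) with (phi r) by ring.
  replace (1 - (1 - xi r)) with (xi r) by ring. reflexivity.
Qed.

Lemma in_cube_swap (r : fractions) : in_cube r -> in_cube (swap_labels r).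
Proof. unfold in_cube, swap_labels; simpl; lra. Qed.

(** The barycentric weight is the mass fraction, because [phi * tau1 = alpha * tau] and
    [phi * e1 = xi * e], and likewise for phase 2. *)
Lemma phases_comb (x : state) (r : fractions) :
  in_cube r -> x = convex_comb (phi r) (phase1 x r) (phase2 x r).
Proof.
  intros [_ [hp _]]. apply state_eq; unfold convex_comb, phase1, phase2; simpl;
    field; lra.
Qed.

Lemma saturation_state_swap (x x1 x2 : state) (r : fractions) :
  saturation_state x x1 x2 r -> saturation_state x x2 x1 (swap_labels r).
Proof.
  intros [hc [h1 [h2 [p1 p2]]]]. split; [exact (in_cube_swap r hc)|].
  rewrite phase1_swap, phase2_swap. simpl. repeat split; auto; lra.
Qed.

(** * Zeros of the vector field *)

Lemma equilibrium_iff (g : vdw) (x : state) (r : fractions) :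
  0 < tau x -> 0 < en x ->
  (equilibrium g x r <->
   in_domain g x r /\
   pressure g (phase1 x r) = pressure g (phase2 x r) /\
   chempot g (phase1 x r) = chempot g (phase2 x r) /\
   temperature g (phase1 x r) = temperature g (phase2 x r)).
Proof.
  intros ht he. unfold equilibrium, rhs. split.
  - intros [hd h]. split; [exact hd|]. injection h as h1 h2 h3.
    destruct hd as [[ha [hp hx]] [D1 D2]].
    pose proof (temperature_pos _ _ D1) as T1.
    pose proof (temperature_pos _ _ D2) as T2.
    set (x1 := phase1 x r) in *. set (x2 := phase2 x r) in *.
    (* The energy equation comes first: once the temperatures agree, the other two equations compare
       fractions with a common denominator. *)
    assert (hT : temperature g x1 = temperature g x2).
    { apply Rinv_eq_reg. apply (Rmult_eq_reg_l (xi r * (1 - xi r) * en x)).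
      - unfold Rdiv in h3. lra.
      - apply Rgt_not_eq. repeat apply Rmult_gt_0_compat; lra. }
    assert (ratio : forall c u v, 0 < c ->
      c * (u / temperature g x1 - v / temperature g x2) = 0 -> u = v).
    { intros c u v hc hz. rewrite hT in hz.
      replace (c * (u / temperature g x2 - v / temperature g x2))
        with (c / temperature g x2 * (u - v)) in hz by (field; lra).
      assert (0 < c / temperature g x2) by (apply Rdiv_lt_0_compat; lra).
      apply Rmult_integral in hz. lra. }
    repeat split; [| |exact hT].
    + refine (ratio _ _ _ _ h1). repeat apply Rmult_lt_0_compat; lra.
    + apply (ratio (phi r * (1 - phi r))).
      * apply Rmult_lt_0_compat; lra.
      * lra.
  - intros [hd [hp [hm hT]]]. split; [exact hd|].
    cbv zeta. rewrite hp, hm, hT. f_equal; [f_equal|]; ring.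
Qed.

Lemma saturation_equilibrium (g : vdw) (x x1 x2 : state) (r : fractions) :
  0 < tau x -> 0 < en x -> coexist g x1 x2 -> saturation_state x x1 x2 r ->
  equilibrium g x r.
Proof.
  intros ht he [D1 [D2 [_ hpmT]]] [hc [_ [_ [p1 p2]]]].
  apply equilibrium_iff; auto. unfold in_domain. rewrite p1, p2. auto.
Qed.

Lemma identified_phases (x : state) (beta : R) :
  0 < beta < 1 ->
  phase1 x (Fractions beta beta beta) = x /\
  phase2 x (Fractions beta beta beta) = x.
Proof.
  intros hb. split; apply state_eq; unfold phase1, phase2; simpl; field; lra.
Qed.

Lemma identified_equilibrium (g : vdw) (x : state) (beta : R) :
  Ds g x -> 0 < tau x -> 0 < en x -> 0 < beta < 1 ->
  equilibrium g x (Fractions beta beta beta).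
Proof.
  intros D ht he hb. destruct (identified_phases x beta hb) as [p1 p2].
  apply equilibrium_iff; auto. unfold in_domain. rewrite p1, p2.
  unfold in_cube; simpl. auto 10.
Qed.

Lemma saturation_coexist (g : vdw) (x x1 x2 : state) :
  saturated_pair g x x1 x2 -> coexist g x1 x2.
Proof. unfold saturated_pair, coexist. tauto. Qed.

Lemma volume_fraction_neq (x : state) (r : fractions) :
  in_cube r -> tau (phase1 x r) <> tau (phase2 x r) -> alpha r <> phi r.
Proof.
  intros [_ [hp _]] hn h. apply hn. unfold phase1, phase2; simpl. rewrite h.
  field; lra.
Qed.

Lemma energy_fraction_neq (x : state) (r : fractions) :
  in_cube r -> en (phase1 x r) <> en (phase2 x r) -> phi r <> xi r.
Proof.
  intros [_ [hp _]] hn h. apply hn. unfold phase1, phase2; simpl. rewrite <- h.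
  field; lra.
Qed.

Lemma coexist_saturation_state (g : vdw) (x : state) (r : fractions) :
  in_cube r -> coexist g (phase1 x r) (phase2 x r) ->
  saturation_state x (phase1 x r) (phase2 x r) r.
Proof.
  intros hc h. split; [exact hc|]. repeat split.
  - apply (volume_fraction_neq x); [exact hc|exact (coexist_tau_neq g _ _ h)].
  - apply (energy_fraction_neq x); [exact hc|exact (coexist_en_neq g _ _ h)].
Qed.

Lemma equal_phases_identified (x : state) (r : fractions) :
  0 < tau x -> 0 < en x -> in_cube r -> phase1 x r = phase2 x r ->
  identified_state r.
Proof.
  intros ht he [ha [hp hx]] h. unfold phase1, phase2 in h. injection h as h1 h2.
  (* If both phases carry the same value of a quantity, the share of phase 1 in it equals its mass
     fraction. This is applied to volume and to energy. *)
  assert (cross : forall c z, 0 < z ->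
    c * z / phi r = (1 - c) * z / (1 - phi r) -> c = phi r).
  { intros c z hz e.
    assert (e' : (c - phi r) * z = 0).
    { replace ((c - phi r) * z) with
        (phi r * (1 - phi r) * (c * z / phi r - (1 - c) * z / (1 - phi r)))
        by (field; lra).
      rewrite e. ring. }
    apply Rmult_integral in e'. lra. }
  exists (phi r). split; [exact hp|].
  apply fractions_eq; simpl;
    [exact (cross _ _ ht h1)|reflexivity|exact (cross _ _ he h2)].
Qed.

(** The alternative is decided by the phasic volumes alone: at a common temperature, equal volumes
    mean equal states. *)
Lemma equilibrium_cases (g : vdw) (x : state) (r : fractions) :
  0 < tau x -> 0 < en x -> equilibrium g x r ->
  coexist g (phase1 x r) (phase2 x r) \/ identified_state r.
Proof.
  intros ht he h. apply equilibrium_iff in h; auto.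
  destruct h as [[hc [D1 D2]] [hp [hm hT]]].
  unfold coexist.
  destruct (Req_dec (tau (phase1 x r)) (tau (phase2 x r))) as [e|n].
  - right. apply (equal_phases_identified x); auto.
    exact (state_eq_temperature g _ _ hT e).
  - left. intuition congruence.
Qed.

(** * Saturation couples and their fractions *)

Lemma coexist_couple (g : vdw) (x x1 x2 : state) :
  coexist g x1 x2 -> strictly_between x x1 x2 -> saturation_couple g x x1 x2.
Proof.
  intros h hb. split.
  - assert (on_segment x x1 x2)
      by (destruct hb as [t [ht e]]; exists t; split; [lra|exact e]).
    unfold coexist in h. unfold saturated_pair. tauto.
  - intros y1 y2 hy. apply (coexist_unique g x); auto.
    + exact (saturation_coexist g x y1 y2 hy).
    + apply hy.
Qed.

Lemma phases_strictly_between (x : state) (r : fractions) :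
  in_cube r -> strictly_between x (phase1 x r) (phase2 x r).
Proof.
  intros hc. exists (phi r). split; [apply hc|exact (phases_comb x r hc)].
Qed.

Lemma fractions_of_comb (x x1 x2 : state) :
  0 < tau x -> 0 < en x -> strictly_between x x1 x2 ->
  0 < tau x1 -> 0 < tau x2 -> 0 < en x1 -> 0 < en x2 ->
  exists r, in_cube r /\ phase1 x r = x1 /\ phase2 x r = x2.
Proof.
  intros ht he [t [bt e]] t1 t2 e1 e2.
  (* The mass fraction is the weight [t]; [alpha] and [xi] are the shares of the volume and energy
     of [x] carried by [x1]. Positivity at both states puts these shares strictly between 0 and
     1. *)
  exists (Fractions (t * tau x1 / tau x) t (t * en x1 / en x)).
  pose proof (f_equal tau e) as et. pose proof (f_equal en e) as ee.
  simpl in et, ee.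
  assert (frac : forall u v z, 0 < u -> 0 < v -> z = t * u + (1 - t) * v ->
    0 < t * u / z < 1).
  { intros u v z hu hv ->.
    assert (0 < t * u) by (apply Rmult_lt_0_compat; lra).
    assert (0 < (1 - t) * v) by (apply Rmult_lt_0_compat; lra).
    split; [apply Rdiv_lt_0_compat; lra|].
    apply Rlt_div_l; lra. }
  split; [|split].
  - repeat split; simpl; try lra;
      (eapply (frac (tau x1) (tau x2)) || eapply (frac (en x1) (en x2))); auto.
  - apply state_eq; simpl; field; lra.
  - apply state_eq; simpl.
    + replace ((1 - t * tau x1 / tau x) * tau x) with (tau x - t * tau x1)
        by (field; lra).
      rewrite et. field; lra.
    + replace ((1 - t * en x1 / en x) * en x) with (en x - t * en x1)
        by (field; lra).
      rewrite ee. field; lra.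
Qed.

(** Distinct volumes determine the weight [phi]; the first phase then determines [alpha] and
    [xi]. *)
Lemma fractions_unique (x x1 x2 : state) (r s : fractions) :
  0 < tau x -> 0 < en x -> tau x1 <> tau x2 -> in_cube r -> in_cube s ->
  phase1 x r = x1 -> phase2 x r = x2 -> phase1 x s = x1 -> phase2 x s = x2 ->
  r = s.
Proof.
  intros ht he hn hr hs r1 r2 q1 q2.
  pose proof (f_equal tau (phases_comb x r hr)) as er.
  pose proof (f_equal tau (phases_comb x s hs)) as es.
  rewrite r1, r2 in er. rewrite q1, q2 in es. simpl in er, es.
  assert (ep : phi r = phi s).
  { apply (Rmult_eq_reg_r (tau x1 - tau x2)); lra. }
  assert (e1 : phase1 x r = phase1 x s) by congruence.
  destruct hr as [_ [hp _]].
  unfold phase1 in e1. rewrite <- ep in e1. injection e1 as ea ex.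
  assert (cancel : forall c d z, 0 < z -> c * z / phi r = d * z / phi r -> c = d).
  { intros c d z hz e. apply (Rmult_eq_reg_r (z / phi r)).
    - unfold Rdiv in *. lra.
    - apply Rgt_not_eq, Rdiv_lt_0_compat; lra. }
  apply fractions_eq;
    [exact (cancel _ _ _ ht ea)|exact ep|exact (cancel _ _ _ he ex)].
Qed.

Theorem proposition4 (g : vdw) (x : state)
  (hx : Ds g x) (htau : 0 < tau x) (hen : 0 < en x) :
  (* the equilibria are exactly the saturation states and the identified ones *)
  (forall r : fractions,
     equilibrium g x r <->
     (exists (x1 x2 : state) (rs : fractions),
        saturation_couple g x x1 x2 /\ strictly_between x x1 x2 /\
        saturation_state x x1 x2 rs /\
        (r = rs \/ r = swap_labels rs))
     \/ identified_state r)
  /\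
  (* item 1: the two saturation equilibria are present (zero-energy states are
     not reachable with xi in ]0,1[) *)
  (forall x1 x2 : state,
     saturation_couple g x x1 x2 -> strictly_between x x1 x2 ->
     0 < en x1 -> 0 < en x2 ->
     exists rs : fractions,
       saturation_state x x1 x2 rs /\
       saturation_state x x2 x1 (swap_labels rs) /\
       equilibrium g x rs /\ equilibrium g x (swap_labels rs) /\
       (forall r : fractions, equilibrium g x r ->
          r = rs \/ r = swap_labels rs \/ identified_state r))
  /\
  (* item 2: every identified state is an equilibrium *)
  (forall beta : R, 0 < beta < 1 ->
     equilibrium g x (Fractions beta beta beta) /\
     phase1 x (Fractions beta beta beta) = x /\
     phase2 x (Fractions beta beta beta) = x).
Proof.
  split; [|split].
  - intros r. split.
    + intros h. destruct (equilibrium_cases g x r htau hen h) as [c|i]; [left|auto].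
      destruct h as [[hc _] _].
      pose proof (phases_strictly_between x r hc) as hb.
      exists (phase1 x r), (phase2 x r), r.
      split; [exact (coexist_couple g x _ _ c hb)|].
      split; [exact hb|]. split; [exact (coexist_saturation_state g x r hc c)|auto].
    + intros [[x1 [x2 [rs [hs [_ [hss hr]]]]]]|[beta [hb ->]]];
        [|apply identified_equilibrium; assumption].
      pose proof (saturation_coexist _ _ _ _ (proj1 hs)) as c.
      destruct hr as [->| ->].
      * exact (saturation_equilibrium g x x1 x2 rs htau hen c hss).
      * exact (saturation_equilibrium g x x2 x1 _ htau hen (coexist_sym _ _ _ c)
                 (saturation_state_swap _ _ _ _ hss)).
  - intros x1 x2 hs hb e1 e2.
    pose proof (saturation_coexist _ _ _ _ (proj1 hs)) as c.
    pose proof c as [[_ [_ [b1 _]]] [[_ [_ [b2 _]]] _]].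
    pose proof (b_nneg g).
    destruct (fractions_of_comb x x1 x2) as [rs [hc [p1 p2]]]; try assumption; try lra.
    assert (hss : saturation_state x x1 x2 rs).
    (* Writing [x1], [x2] as phases of [rs] turns distinct volumes and energies into [alpha <> phi]
       and [phi <> xi]. *)
    { rewrite <- p1, <- p2 in c |- *. exact (coexist_saturation_state g x rs hc c). }
    pose proof (saturation_state_swap _ _ _ _ hss) as hsw.
    exists rs. split; [exact hss|]. split; [exact hsw|].
    split; [exact (saturation_equilibrium g x x1 x2 rs htau hen c hss)|].
    split; [exact (saturation_equilibrium g x x2 x1 _ htau hen (coexist_sym _ _ _ c) hsw)|].
    intros r h. destruct (equilibrium_cases g x r htau hen h) as [cr|i]; [|auto].
    destruct h as [[hcr _] _].
    pose proof (coexist_tau_neq g x1 x2 c) as hn.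
    (* The phases of [r] form another saturated pair for [x], hence are [x1], [x2] in one order or
       the other, and the fractions follow. *)
    destruct (coexist_couple g x _ _ cr (phases_strictly_between x r hcr)) as [hsr _].
    destruct (proj2 hs _ _ hsr) as [[q1 q2]|[q1 q2]].
    + left. apply (fractions_unique x x1 x2); assumption.
    + right; left. apply (fractions_unique x x2 x1); auto; apply hsw.
  - intros beta hb. split; [exact (identified_equilibrium g x beta hx htau hen hb)|].
    exact (identified_phases x beta hb).
Qed.
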